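(* Let $G$ be a hyperbolic group and let $H\le G$ be an arbitrary subgroup. Then the relative growth rate of $H$ exists with respect to every finite generating set of $G$; that is, for every finite generating set $X$ of $G$ the limit $\lim_{n\to\infty}\sqrt[n]{\beta_H^X(n)}$ exists.
   Context: A hyperbolic group is a finitely generated group whose Cayley graph with respect to some (equivalently any) finite generating set is Gromov hyperbolic. For a group $G$ with finite generating set $X$, $|g|_X$ denotes word length with respect to $X\cup X^{-1}$. For a subgroup $H\le G$ (not necessarily finitely generated) and $n\in\mathbb{N}$, $B_H^X(n)=\{h\in H : |h|_X\le n\}$ and $\beta_H^X(n)=|B_H^X(n)|$. The relative (exponential) growth rate of $H$ with respect to $X$ is said to exist if $\lim_{n\to\infty}\sqrt[n]{\beta_H^X(n)}$ exists. *)

(* Defs.v *)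
From HB Require Import structures.
From mathcomp Require Import all_boot all_order all_algebra.
From mathcomp Require Import finmap.
From mathcomp Require Import all_classical all_reals all_analysis.

Set Implicit Arguments.
Unset Strict Implicit.
Unset Printing Implicit Defensive.

Import Order.TTheory GRing.Theory Num.Theory.
Import numFieldNormedType.Exports.

Local Open Scope classical_set_scope.
Local Open Scope ring_scope.

(* Junk value 0 when A is empty. *)
Definition least_nat (A : set nat) : nat :=
  xget 0%N [set n | A n /\ forall m, A m -> (n <= m)%N].

Section Groups.
Variable G : groupType.
Implicit Types (X H : set G) (g h : G) (n : nat).

Definition is_subgroup H : Prop := group_closed [in H].

Definition generates X : Prop := smallest is_subgroup X = [set: G].

Definition finite_generating_set X : Prop := finite_set X /\ generates X.

Definition sym_closure X : set G := X `|` [set x | X (x^-1)%g].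

Definition word_length X g : nat :=
  least_nat [set n | exists w : seq G,
    [/\ {in w, forall x, sym_closure X x},
        (\prod_(x <- w) x)%g = g & size w = n]].

Definition rel_ball X H n : set G := [set h | H h /\ (word_length X h <= n)%N].

(* [fset_set] is junk on infinite sets; these balls are finite as soon as X is
   a finite generating set. *)
Definition rel_growth X H n : nat := #|` fset_set (rel_ball X H n)|.

Definition cayley_graph X : rel G :=
  fun g h => `[< exists2 x, sym_closure X x & h = (g * x)%g >].

End Groups.

Definition graph_dist (T : eqType) (e : rel T) (x y : T) : nat :=
  least_nat [set n | exists p : seq T, [/\ path e x p, last x p = y & size p = n]].

Section Hyperbolicity.
Variable R : realType.

Definition gromov_product (T : Type) (d : T -> T -> R) (w x y : T) : R :=
  (d x w + d y w - d x y) / 2%:R.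

Definition gromov_hyperbolic (T : Type) (d : T -> T -> R) : Prop :=
  exists delta : R, forall w x y z : T,
    Num.min (gromov_product d w x y) (gromov_product d w y z) - delta
      <= gromov_product d w x z.

(* A graph is identified with its vertex set equipped with the path metric; its
   geometric realization is at bounded distance from it, so this only affects
   the value of delta. *)
Definition hyperbolic_graph (T : eqType) (e : rel T) : Prop :=
  gromov_hyperbolic (fun x y : T => (graph_dist e x y)%:R : R).

Definition hyperbolic_group (G : groupType) : Prop :=
  exists X : set G, finite_generating_set X /\ hyperbolic_graph (cayley_graph X).

(* The n-th root is a real power; the term at n = 0 is 1 since 0^-1 = 0. *)
Definition rel_growth_rate_exists (G : groupType) (X H : set G) : Prop :=
  exists l : R,
    (fun n : nat => (rel_growth X H n)%:R `^ (n%:R)^-1 : R) @ \oo --> l.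

End Hyperbolicity.

(* Main.v *)
Require Import Defs.
From mathcomp Require Import all_boot all_order all_algebra.
From mathcomp Require Import finmap zify lra.
From mathcomp Require Import all_classical all_reals all_analysis.

(** Write |g| for the word length in a generating set Y whose Cayley graph is
    hyperbolic, and beta(n) for the number of elements of H of X-length at most
    n.  The limit exists because beta is supermultiplicative up to a linear
    factor and a shift of the argument,
      beta(n) * beta(m) <= A * (n + 1) * beta(n + m + N),
    so that ln beta is almost superadditive and a variant of Fekete's lemma
    applies.  The inequality comes from a dichotomy on H.

    Either H has bridges: for some M and C, any h and k in H can be joined by
    some a in H with |a| <= M such that |h| + |a k| <= |h a k| + C, that is, h
    is almost on a geodesic from 1 to g := h a k.  In a hyperbolic space h is
    then within a bounded distance of one of the at most |h| + 1 first vertices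
    of that geodesic, so that g, a, the position on the geodesic and a bounded
    error determine (h, k).  Counting these data bounds beta(n) * beta(m)
    (rel_growth_bridges).

    Or bridges fail for all M and C.  Failure for M and a large C provides k in
    H such that k and a k are very close to each other, seen from 1, for all a
    in H with |a| <= M: morally H fixes a point at infinity.  Then each such a
    maps a vertex of a geodesic from 1 to k, chosen far enough from 1, to a
    point near the same geodesic.  Since a is determined by the image of that
    vertex, only linearly many such a exist (rel_growth_no_bridge), and linear
    growth implies the inequality as well.

    The two word lengths are compared only to bound lengths of bridges and numbers
    of positions on a geodesic, at the cost of constants in A and N.  This is why
    X may be arbitrary although the geometry takes place in the Cayley graph of
    Y. *)

Set Implicit Arguments.
Unset Strict Implicit.
Unset Printing Implicit Defensive.

Import Order.TTheory GRing.Theory Num.Theory.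
Import numFieldNormedType.Exports.

Local Open Scope classical_set_scope.
Local Open Scope nat_scope.

(** * Least numbers and counting by codes *)

Lemma least_natP (A : set nat) n :
  A n -> A (least_nat A) /\ forall m, A m -> least_nat A <= m.
Proof.
move=> An.
apply: (@xgetPex _ 0 [set n | A n /\ forall m, A m -> n <= m]).
have exA : exists n, `[< A n >] by exists n; apply/asboolP.
have [k /asboolP Ak lek] := ex_minnP exA.
by exists k; split=> // m Am; apply: lek; apply/asboolP.
Qed.

(** Codes are related to elements instead of computed from them: below, the code
    of an element involves choices that only exist for the elements counted. *)
Lemma leq_size_code (T U : eqType) (P : T -> U -> Prop) (s : seq T) (t : seq U) :
  uniq s -> (forall x, x \in s -> exists2 c, c \in t & P x c) ->
  (forall x y c, P x c -> P y c -> x = y) -> size s <= size t.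
Proof.
case: s => [//|x0 s] us exc injP.
have [c0 _ _] := exc x0 (mem_head _ _).
have /choice[f fP] x : exists c, x \in x0 :: s -> c \in t /\ P x c.
  have [/exc[c ct Pc]|_] := boolP (x \in x0 :: s); first by exists c.
  by exists c0.
rewrite -(size_map f); apply: uniq_leq_size.
  rewrite map_inj_in_uniq // => x y /fP[_ Px] /fP[_ Py] fxy.
  by apply: injP Px _; rewrite fxy.
by move=> _ /mapP[x /fP[ft _] ->].
Qed.

(** * Word length and growth *)

Section WordLength.
Context {G : groupType}.
Implicit Types (X H : set G) (g h : G) (n : nat) (w : seq G).

Definition spells X w g : Prop :=
  {in w, forall x, sym_closure X x} /\ (\prod_(x <- w) x)%g = g.

Lemma spells_cat X w1 w2 g1 g2 :
  spells X w1 g1 -> spells X w2 g2 -> spells X (w1 ++ w2) (g1 * g2)%g.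
Proof.
move=> [s1 <-] [s2 <-]; split; last by rewrite big_cat.
by move=> x; rewrite mem_cat => /orP[/s1|/s2].
Qed.

Lemma spells_rev X w g :
  spells X w g -> spells X (rev (map (fun x => x^-1)%g w)) (g^-1)%g.
Proof.
move=> [sw <-]; split=> [x|].
  rewrite mem_rev => /mapP[y /sw Xy ->].
  by case: Xy => Xy; [right; rewrite /= invgK|left].
elim: w {sw} => [|x w IHw] /=; first by rewrite !big_nil invg1.
by rewrite rev_cons -cats1 big_cat /= IHw !big_cons big_nil mulg1 invgM.
Qed.

Lemma generates_spells X g : generates X -> exists w, spells X w g.
Proof.
move=> genX.
have : (smallest (@is_subgroup G) X) g by rewrite genX.
move/(_ [set g | exists w, spells X w g]); apply; split; last first.
  move=> x Xx; exists [:: x]; split; last by rewrite big_seq1.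
  by move=> y; rewrite inE => /eqP ->; left.
split; first by rewrite inE; exists [::]; split; rewrite ?big_nil.
move=> x y; rewrite !inE => -[wx sx] [wy sy].
by exists (wx ++ rev (map (fun x => x^-1)%g wy)); apply/spells_cat/spells_rev.
Qed.

Lemma word_length_spells X g :
  generates X -> exists2 w, spells X w g & size w = word_length X g.
Proof.
move=> /generates_spells -/(_ g)[w [sw gw]].
have [|[v [sv gv zv]] _] := @least_natP [set n | exists w : seq G,
    [/\ {in w, forall x, sym_closure X x}, (\prod_(x <- w) x)%g = g & size w = n]]
    (size w).
  by exists w.
by exists v.
Qed.

Lemma word_length_le X w g : spells X w g -> word_length X g <= size w.
Proof.
move=> [sw gw].
have [|_] := @least_natP [set n | exists w : seq G,
    [/\ {in w, forall x, sym_closure X x}, (\prod_(x <- w) x)%g = g & size w = n]]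
    (size w); first by exists w.
by apply; exists w.
Qed.

Lemma word_length1 X : word_length X 1%g = 0.
Proof.
by apply/eqP; rewrite -leqn0; apply: (@word_length_le X [::]); split; rewrite ?big_nil.
Qed.

Lemma word_lengthM X g h : generates X ->
  word_length X (g * h)%g <= word_length X g + word_length X h.
Proof.
move=> genX.
have [v sv <-] := word_length_spells g genX.
have [w sw <-] := word_length_spells h genX.
by rewrite -size_cat; apply/word_length_le/spells_cat.
Qed.

Lemma word_lengthV X g : generates X -> word_length X (g^-1)%g = word_length X g.
Proof.
move=> genX.
suff le x : word_length X (x^-1)%g <= word_length X x.
  by apply/eqP; rewrite eqn_leq le -{1}[g]invgK le.
have [w sw <-] := word_length_spells x genX.
by rewrite -(size_map (fun x => x^-1)%g) -size_rev; apply/word_length_le/spells_rev.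
Qed.

(** Splitting a shortest word gives the vertices of a geodesic from 1 to g. *)
Lemma word_length_split X g t : generates X -> t <= word_length X g ->
  exists2 p, word_length X p = t & word_length X (p^-1 * g)%g = word_length X g - t.
Proof.
move=> genX tg; have [w [sw gw] zw] := word_length_spells g genX.
have s1 : spells X (take t w) (\prod_(x <- take t w) x)%g.
  by split=> // x /mem_take /sw.
have s2 : spells X (drop t w) (\prod_(x <- drop t w) x)%g.
  by split=> // x /mem_drop /sw.
set p := (\prod_(x <- take t w) x)%g in s1.
set q := (\prod_(x <- drop t w) x)%g in s2.
have gpq : (p * q)%g = g by rewrite -gw -[in RHS](cat_take_drop t w) big_cat.
have := word_length_le s1; have := word_length_le s2.
have := word_lengthM p q genX.
rewrite size_drop size_takel ?zw // gpq => lg lq lp.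
exists p; first lia.
by rewrite -{1}gpq mulKg; lia.
Qed.

Lemma word_length_Lipschitz X Y : generates X -> finite_generating_set Y ->
  exists L, forall g, word_length X g <= L * word_length Y g.
Proof.
move=> genX [/finite_seqP[s Ys] genY].
exists (\max_(y <- s) word_length X y) => g.
have [w [sw <-] <-] := word_length_spells g genY.
elim: w sw => [|x w IHw] sw; first by rewrite big_nil word_length1.
rewrite big_cons /= mulnS; apply: leq_trans (word_lengthM _ _ genX) _.
apply: leq_add; last by apply: IHw => y yw; apply: sw; rewrite inE yw orbT.
have xs : exists2 y, y \in s & word_length X x = word_length X y.
  have := sw x (mem_head _ _); rewrite /sym_closure Ys => -[|] /= xs.
    by exists x.
  by exists (x^-1)%g; rewrite ?word_lengthV.
have [y ys ->] := xs; exact: leq_bigmax_seq.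
Qed.

(** Padding with the letter 1 turns words of length at most n into words of
    length exactly n, whence the exact size of the cover. *)
Lemma word_ball_cover X : finite_generating_set X -> exists c, forall n,
  exists2 l : seq G, size l = c ^ n & forall g, word_length X g <= n -> g \in l.
Proof.
move=> [/finite_seqP[s Xs] genX].
pose S := 1%g :: s ++ map (fun x => x^-1)%g s; exists (size S).
elim=> [|n [l zl lP]].
  exists [:: 1%g] => // g; rewrite leqn0 => /eqP g0.
  have [w [_ gw]] := word_length_spells g genX.
  by rewrite g0 -gw => /size0nil ->; rewrite big_nil inE.
exists [seq (x * y)%g | x <- S, y <- l]; first by rewrite size_allpairs zl expnS.
move=> g; have [[|x w] [sw gw] zw] := word_length_spells g genX; rewrite -{}zw.
  move=> _; apply/allpairsPdep; exists 1%g, 1%g; split=> /=; first exact: mem_head.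
    by apply: lP; rewrite word_length1.
  by rewrite -gw big_nil mulg1.
move=> zw; apply/allpairsPdep; exists x, (\prod_(y <- w) y)%g; split=> /=.
- rewrite inE mem_cat; apply/orP; right.
  have := sw x (mem_head _ _); rewrite /sym_closure Xs => -[|] /= xs.
    by rewrite xs.
  by apply/orP; right; apply/mapP; exists (x^-1)%g; rewrite ?invgK.
- apply: lP; apply: (@leq_trans (size w)) zw; apply: word_length_le; split=> // y yw.
  by apply: sw; rewrite inE yw orbT.
- by rewrite -gw big_cons.
Qed.

Lemma rel_ball_finite X H n : finite_generating_set X -> finite_set (rel_ball X H n).
Proof.
move=> /word_ball_cover[c /(_ n)[l _ lP]].
apply: (@sub_finite_set _ _ [set` l]); last by apply/finite_seqP; exists l.
by move=> g [_ /lP].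
Qed.

Lemma mem_rel_ball X H n g : finite_generating_set X ->
  (g \in fset_set (rel_ball X H n)) <-> H g /\ word_length X g <= n.
Proof.
by move=> fX; rewrite in_fset_set ?inE //; apply: rel_ball_finite.
Qed.

Lemma rel_growth_mono X H n m :
  finite_generating_set X -> n <= m -> rel_growth X H n <= rel_growth X H m.
Proof.
move=> fX nm; apply: fsubset_leq_card; apply/fsubsetP => g.
rewrite !mem_rel_ball // => -[Hg gn]; split=> //; exact: leq_trans nm.
Qed.

Lemma rel_growth_gt0 X H n :
  finite_generating_set X -> is_subgroup H -> 0 < rel_growth X H n.
Proof.
move=> fX [+ _]; rewrite inE => H1.
rewrite /rel_growth cardfs_gt0; apply/fset0Pn; exists 1%g.
by apply/mem_rel_ball => //; rewrite word_length1.
Qed.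

Lemma rel_growth_exp X H : finite_generating_set X ->
  exists c, forall n, rel_growth X H n <= c ^ n.
Proof.
move=> fX; have [c cP] := word_ball_cover fX; exists c => n.
have [l <- lP] := cP n; apply: uniq_leq_size; first exact: fset_uniq.
by move=> g /mem_rel_ball -/(_ fX)[_ /lP].
Qed.

Lemma rel_growth_dilate X Y H L n : finite_generating_set X -> finite_generating_set Y ->
  (forall g, word_length Y g <= L * word_length X g) ->
  rel_growth X H n <= rel_growth Y H (L * n).
Proof.
move=> fX fY YX; apply: fsubset_leq_card; apply/fsubsetP => g.
rewrite !mem_rel_ball // => -[Hg gn]; split=> //.
by apply: leq_trans (YX g) _; rewrite leq_mul2l gn orbT.
Qed.

End WordLength.

(** * Hyperbolicity as a four-point inequality between natural numbers *)

Section Hyperbolic.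
Context {G : groupType}.
Implicit Types (X Y H : set G) (g h k : G) (D : nat).

Definition word_dist X g h := word_length X (g^-1 * h)%g.

Lemma word_dist1 X g : word_dist X 1%g g = word_length X g.
Proof. by rewrite /word_dist invg1 mul1g. Qed.

Lemma word_distC X g h : generates X -> word_dist X g h = word_dist X h g.
Proof. by move=> genX; rewrite /word_dist -word_lengthV // invgM invgK. Qed.

Lemma word_dist_triangle X g h k : generates X ->
  word_dist X g k <= word_dist X g h + word_dist X h k.
Proof.
move=> genX; rewrite /word_dist.
by have := word_lengthM (g^-1 * h)%g (h^-1 * k)%g genX; rewrite -mulgA mulVKg.
Qed.

Lemma word_distMl X a g h : word_dist X (a * g)%g (a * h)%g = word_dist X g h.
Proof. by rewrite /word_dist invgM -mulgA mulKg. Qed.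

Lemma word_distVl X g h : word_dist X (g^-1)%g h = word_length X (g * h)%g.
Proof. by rewrite /word_dist invgK. Qed.

(** A path in the Cayley graph from g to h reads a word spelling g^-1 h. *)
Lemma graph_dist_cayley X g h : graph_dist (cayley_graph X) g h = word_dist X g h.
Proof.
congr least_nat; apply/seteqP; split=> n [].
  move=> p [+ <- <-]; elim: p g => [|x p IHp] g /=.
    by move=> _; exists [::]; rewrite big_nil mulVg; split.
  move=> /andP[/asboolP[y Xy ->] /IHp[w [sw gw zw]]]; exists (y :: w); split=> /=.
  - by move=> z; rewrite inE => /orP[/eqP ->|/sw].
  - by rewrite big_cons gw invgM !mulgA mulgV mul1g.
  - by rewrite zw.
move=> w [+ gw <-].
have -> : h = (g * \prod_(x <- w) x)%g by rewrite gw mulVKg.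
elim: w g {gw} => [|x w IHw] g sw.
  by exists [::]; rewrite /= big_nil mulg1; split.
have [|p [pp lp zp]] := IHw (g * x)%g.
  by move=> y yw; apply: sw; rewrite inE yw orbT.
exists ((g * x)%g :: p); split; rewrite /= ?zp //; last by rewrite lp big_cons mulgA.
by rewrite pp andbT; apply/asboolP; exists x => //; apply/sw/mem_head.
Qed.

(** Twice Gromov's inequality with the Gromov products expanded, where D bounds
    twice the hyperbolicity constant.  In this form the geometric arguments become
    linear arithmetic over the natural numbers. *)
Definition four_point X D : Prop := forall w x y z,
  word_dist X x z + word_dist X y w <=
    maxn (word_dist X x y + word_dist X z w) (word_dist X y z + word_dist X x w) + D.

Lemma hyperbolic_four_point (R : realType) X :
  hyperbolic_graph R (cayley_graph X) -> exists D, four_point X D.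
Proof.
move=> [delta hyp]; exists (Num.bound `|2 * delta|%R) => w x y z.
have : (2 * delta <= (Num.bound `|2 * delta|)%:R)%R.
  by apply: le_trans (ler_norm _) _; apply/ltW/archi_boundP.
move: (Num.bound _) => D deltaD; move: (hyp w x y z).
rewrite /gromov_product !graph_dist_cayley lerBlDr ge_min -(ler_nat R) !natrD.
rewrite natr_max !natrD => /orP[] le; rewrite -lerBlDr le_max; apply/orP; [left|right]; lra.
Qed.

Definition geodesic X g (p : nat -> G) : Prop := forall t, t <= word_length X g ->
  word_dist X 1%g (p t) = t /\ word_dist X (p t) g = word_length X g - t.

Lemma geodesic_exists X : generates X -> exists p, forall g, geodesic X g (p g).
Proof.
move=> genX.
have /choice[p pP] (gt : G * nat) : exists q, gt.2 <= word_length X gt.1 ->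
    word_dist X 1%g q = gt.2 /\ word_dist X q gt.1 = word_length X gt.1 - gt.2.
  have [/word_length_split[//|q q1 q2]|_] := leqP gt.2 (word_length X gt.1).
    by exists q; rewrite word_dist1.
  by exists 1%g.
by exists (fun g t => p (g, t)) => g t; exact: (pP (g, t)).
Qed.

(** This is where thin triangles enter: a point for which the triangle inequality
    between 1 and g is an equality up to C is close to the vertex of the geodesic
    at the same distance from 1.  The minimum in the proof covers points beyond
    the end of the geodesic. *)
Lemma near_geodesic X D C g h p : generates X -> four_point X D -> geodesic X g p ->
  word_dist X 1%g h + word_dist X h g <= word_length X g + C ->
  exists2 t, t <= word_length X h & word_dist X (p t) h <= C + D.
Proof.
move=> genX hypX gp le; set t := minn (word_length X h) (word_length X g).
exists t; first exact: geq_minl.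
have [|p1 p2] := gp t; first exact: geq_minr.
have := hypX (p t) 1%g h g.
rewrite p1 (word_distC g) // p2 (word_distC h) // !word_dist1.
by rewrite word_dist1 in le; lia.
Qed.

(** The pair (h, k) is recovered from g = h a k, the bridge a, the time t at which
    the geodesic to g passes near h, and the error z between that vertex and h.
    There are only linearly many times, because t <= |h|. *)
Lemma rel_growth_bridges X Y H D M C : finite_generating_set X -> finite_generating_set Y ->
  is_subgroup H -> four_point Y D ->
  (forall h k, H h -> H k -> exists a, [/\ H a, word_length Y a <= M &
     word_length Y h + word_length Y (a * k)%g <= word_length Y (h * a * k)%g + C]) ->
  exists A N, forall n m,
    rel_growth X H n * rel_growth X H m <= A * n.+1 * rel_growth X H (n + m + N).
Proof.
move=> fX fY sH hypY bridge; have [genX genY] := (fX.2, fY.2).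
have [L XY] := word_length_Lipschitz genX fY.
have [K YX] := word_length_Lipschitz genY fX.
have [p pP] := geodesic_exists genY.
pose A := rel_growth Y H M * (K.+1 * rel_growth Y setT (C + D)).
exists A, (L * M) => n m.
pose ball Z S r := enum_fset (fset_set (rel_ball (G := G) Z S r)).
pose pairs := [seq (h, k) | h <- ball X H n, k <- ball X H m].
pose codes := [seq (g, az) | g <- ball X H (n + m + L * M), az <-
  [seq (a, tz) | a <- ball Y H M, tz <-
    [seq (t, z) | t <- iota 0 (K * n).+1, z <- ball Y setT (C + D)]]].
have -> : rel_growth X H n * rel_growth X H m = size pairs by rewrite size_allpairs.
apply: (@leq_trans (size codes)); last first.
  rewrite !size_allpairs size_iota [leqRHS]mulnC leq_mul2l; apply/orP; right.
  rewrite -[leqRHS]mulnA leq_mul2l; apply/orP; right.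
  by rewrite mulnAC leq_mul2r; apply/orP; right; nia.
apply: (@leq_size_code _ _ (fun hk c =>
  let: (g, (a, (t, z))) := c in g = (hk.1 * a * hk.2)%g /\ hk.1 = (p g t * z)%g)).
- apply: allpairs_uniq; try exact: fset_uniq.
  by case=> [? ?] [? ?] _ _ [-> ->].
- move=> _ /allpairsPdep[h [k [hB kB ->]]].
  have [[Hh hn] [Hk km]] := ((mem_rel_ball H n h fX).1 hB, (mem_rel_ball H m k fX).1 kB).
  have [a [Ha aM le]] := bridge h k Hh Hk.
  pose g := (h * a * k)%g.
  have [|t th zt] := @near_geodesic Y D C g h (p g) genY hypY (pP g).
    by rewrite word_dist1 /word_dist /g !mulgA mulVg mul1g.
  exists (g, (a, (t, ((p g t)^-1 * h)%g))); last by rewrite mulVKg.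
  have HM x y : H x -> H y -> H (x * y)%g.
    by have := @group_closedM _ _ sH x y; rewrite !inE.
  apply: allpairs_f; last apply: allpairs_f; last apply: allpairs_f.
  + apply/mem_rel_ball => //; split.
      by apply: (HM) => //; apply: HM.
    apply: leq_trans (word_lengthM _ _ genX) _; rewrite addnAC leq_add //.
    apply: leq_trans (word_lengthM _ _ genX) _; rewrite leq_add //.
    by apply: leq_trans (XY a) _; rewrite leq_mul2l aM orbT.
  + exact/mem_rel_ball.
  + rewrite mem_iota add0n ltnS /=; apply: leq_trans th _.
    by apply: leq_trans (YX h) _; rewrite leq_mul2l hn orbT.
  + exact/mem_rel_ball.
- move=> [h k] [h' k'] [g [a [t z]]] /= [gE hE] [gE' hE'].
  have hh' : h = h' by rewrite hE hE'.
  by move: gE'; rewrite -hh' gE => /mulgI ->.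
Qed.

(** Without bridges, some k in H has a large Gromov product with a k, based at 1,
    for all a in H of length at most n.  Geodesics from 1 to k and from a to a k
    then run close together in between, so that a shifts a suitable vertex q of
    the former along it.  Thus a is recovered from the position and the error of
    a q relative to the geodesic. *)
Lemma rel_growth_no_bridge Y H D :
  finite_generating_set Y -> is_subgroup H -> four_point Y D ->
  (forall M C, exists h k, [/\ H h, H k & forall a, H a -> word_length Y a <= M ->
     word_length Y (h * a * k)%g + C < word_length Y h + word_length Y (a * k)%g]) ->
  exists A, forall n, rel_growth Y H n <= A * n.+1.
Proof.
move=> fY sH hypY noBridge; have genY := fY.2.
have [p pP] := geodesic_exists genY.
have sH1 : H 1%g by have := sH.1; rewrite inE.
exists (D.+2.*2 * rel_growth Y setT (2 * D + D)) => n.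
(* At time t0 > n + D the four-point inequality for 1, a, a q, a k can only hold
   through the pairing that puts a q almost on a geodesic from 1 to a k. *)
have [t0 t0E] : exists t0, t0 = n + D + 1 by exists (n + D + 1).
(* Since |a q| <= n + t0, this constant makes a k and k branch off beyond a q. *)
have [h [k [Hh Hk far]]] := noBridge n (2 * (n + t0) + 3 * D).
(* Both k and a k are aligned with h^-1 from 1, hence with each other. *)
have farN a : H a -> word_length Y a <= n ->
    word_dist Y k (a * k)%g + 2 * (n + t0) + 2 * D < word_length Y k + word_length Y (a * k)%g.
  move=> Ha an.
  have := far a Ha an; have := far 1%g.
  rewrite word_length1 mulg1 mul1g => /(_ _ isT) far1.
  have {far1} := far1 sH1.
  have xak : word_dist Y (h^-1)%g (a * k)%g = word_length Y (h * a * k)%g.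
    by rewrite word_distVl mulgA.
  have := hypY (a * k)%g 1%g k (h^-1)%g.
  by rewrite !word_dist1 word_lengthV // (word_distC k (h^-1)%g) // xak word_distVl; lia.
have [|q1 qk] := pP k t0; last set q := p k t0 in q1 qk.
  have := far 1%g; rewrite word_length1 mulg1 mul1g => /(_ sH1 isT).
  have := word_lengthM (h * k)%g (k^-1)%g genY; rewrite mulgK word_lengthV //; lia.
have near a : H a -> word_length Y a <= n ->
    exists2 t, t <= n + t0 & word_dist Y (p k t) (a * q)%g <= 2 * D + D.
  move=> Ha an; have := farN a Ha an.
  have aq : word_dist Y a (a * q)%g = t0.
    by have := word_distMl Y a 1%g q; rewrite mulg1 => ->.
  have aqak : word_dist Y (a * q)%g (a * k)%g = word_length Y k - t0 by rewrite word_distMl.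
  have aak : word_dist Y a (a * k)%g = word_length Y k.
    by have := word_distMl Y a 1%g k; rewrite mulg1 word_dist1.
  have t1 := word_dist_triangle 1%g a (a * q)%g genY.
  have t2 := word_dist_triangle a 1%g (a * q)%g genY.
  have t3 := word_dist_triangle 1%g (a * q)%g k genY.
  have := hypY (a * q)%g a 1%g (a * k)%g.
  have := hypY k 1%g (a * q)%g (a * k)%g.
  rewrite (word_distC a 1%g) // in t2 *.
  rewrite (word_distC (a * k)%g k) // (word_distC (a * k)%g (a * q)%g) //.
  rewrite !word_dist1 in t1 t2 t3 *.
  rewrite aq aqak aak in t1 t2 t3 * => h2 h1 kak.
  have [|t tq tz] := @near_geodesic Y D (2 * D) k (a * q)%g (p k) genY hypY (pP k).
    by rewrite word_dist1; lia.
  by exists t => //; lia.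
pose codes := [seq (t, z) | t <- iota 0 (n + t0).+1,
  z <- enum_fset (fset_set (rel_ball Y [set: G] (2 * D + D)))].
apply: (@leq_trans (size codes)).
  apply: (@leq_size_code _ _ (fun a c => (a * q)%g = (p k c.1 * c.2)%g)).
  - exact: fset_uniq.
  - move=> a /mem_rel_ball -/(_ fY)[Ha /(near _ Ha)[t tn tz]].
    exists (t, (p k t)^-1 * (a * q))%g; last by rewrite mulVKg.
    apply: allpairs_f; first by rewrite mem_iota add0n ltnS.
    exact/mem_rel_ball.
  - by move=> a b c aE bE; apply: (mulIg q); rewrite aE bE.
rewrite size_allpairs size_iota mulnAC leq_mul2r; apply/orP; right.
rewrite t0E; nia.
Qed.

End Hyperbolic.

(** In the linear case beta(n) is absorbed by the factor A * (n + 1), and beta is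
    monotone. *)
Lemma rel_growth_almost_supermult (R : realType) (G : groupType) (X H : set G) :
  hyperbolic_group R G -> finite_generating_set X -> is_subgroup H ->
  exists A N, forall n m,
    rel_growth X H n * rel_growth X H m <= A * n.+1 * rel_growth X H (n + m + N).
Proof.
move=> [Y [fY /hyperbolic_four_point[D hypY]]] fX sH.
pose bridge h k M C := exists a, [/\ H a, word_length Y a <= M &
  word_length Y h + word_length Y (a * k)%g <= word_length Y (h * a * k)%g + C].
have [[M [C MC]]|noBridge] := pselect (exists M C, forall h k, H h -> H k -> bridge h k M C).
  exact: rel_growth_bridges MC.
have [|A lin] := @rel_growth_no_bridge G Y H D fY sH hypY.
  move=> M C; apply: contra_notP noBridge => noFar; exists M, C => h k Hh Hk.
  apply: contra_notP noFar => noBridge; exists h, k; split=> // a Ha aM.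
  by rewrite ltnNge; apply/negP => le; apply: noBridge; exists a.
have [K YX] := word_length_Lipschitz fY.2 fX.
exists (A * K.+1), 0 => n m; apply: leq_mul.
  apply: leq_trans (rel_growth_dilate H n fX fY YX) _; apply: leq_trans (lin _) _.
  by rewrite -mulnA leq_mul2l; apply/orP; right; nia.
by apply: rel_growth_mono => //; lia.
Qed.

(** * Almost superadditive sequences *)

Section Fekete.
Context {R : realType}.
Local Open Scope ring_scope.

Lemma near_le_linear (C e : R) : 0 < e -> \forall n \near \oo, C <= e * n%:R.
Proof.
move=> e0; near=> n; rewrite mulrC -ler_pdivrMr //; near: n; exact: nbhs_infty_ger.
Unshelve. all: by end_near. Qed.

(** The quadratic lower bound on the exponential beats any affine function. *)
Lemma ln_affine_sublinear (A e : R) : 0 < A -> 0 < e ->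
  \forall n \near \oo, ln (A * n.+1%:R) <= e * n%:R.
Proof.
move=> A0 e0; near=> n.
rewrite -ler_expR lnK; last by rewrite posrE mulr_gt0.
apply: le_trans (expR_ge1Dxn 1%N _); last by rewrite mulr_ge0 // ltW.
have n1 : 1 <= n%:R :> R by near: n; exact: nbhs_infty_ger.
have : 4 * A <= e ^+ 2 * n%:R.
  by near: n; apply: near_le_linear; rewrite exprn_gt0.
move=> /(ler_wpM2r (le_trans ler01 n1)).
rewrite -natr1 exprMn; set x := n%:R in n1 *; move: (e ^+ 2) => e2 le.
have : A * 1 <= A * x by rewrite ler_pM2l.
rewrite (_ : 2`! = 2)%N // ; lra.
Unshelve. all: by end_near. Qed.

(** The error f n depends on one of the two arguments only.  Iterating with n fixed
    therefore loses it once per block of length n + N, so that every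
    (u n - f n) / (n + N) is asymptotically a lower bound for u m / m; at n = m it
    is also almost an upper bound, since f is sublinear.  Hence the limit is the
    supremum of these quotients. *)
Lemma almost_superadditive_cvg (u f : nat -> R) (N : nat) (K : R) :
  (forall n, 0 <= u n <= K * n%:R) ->
  (forall n m, u n + u m <= f n + u (n + m + N)%N) ->
  (forall e, 0 < e -> \forall n \near \oo, f n <= e * n%:R) ->
  exists l : R, (fun n => u n / n%:R) @ \oo --> l.
Proof.
move=> uK uD fo.
have u0 n : 0 <= u n by have /andP[] := uK n.
have iter n q r : (u n - f n) *+ q <= u (q * (n + N) + r)%N.
  elim: q => [|q IHq]; first by rewrite mulr0n.
  have -> : (q.+1 * (n + N) + r = n + (q * (n + N) + r) + N)%N by lia.
  by have := uD n (q * (n + N) + r)%N; rewrite mulrS; lra.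
pose c n := (u n - f n) / (n + N)%:R.
pose S := [set c n | n in [set n | (0 < n)%N]].
have npos n : (0 < n)%N -> 0 < (n + N)%:R :> R by move=> n0; rewrite ltr0n; lia.
have ubS : ubound S K.
  move=> _ [n /= n0 <-]; rewrite /c ler_pdivrMr ?npos //.
  have := iter n 1%N 0%N; rewrite mulr1n mul1n addn0.
  by have /andP[_] := uK (n + N)%N; lra.
have supS : has_sup S by split; [exists (c 1%N), 1%N|exists K].
exists (sup S); apply/cvgrPdist_le => e e0.
have e2 : 0 < e / 2 by lra.
have [_ [n /= n0 <-] cn] := sup_adherent e2 supS.
near=> m.
have m0 : 0 < m%:R :> R by rewrite ltr0n; near: m; exact: nbhs_infty_gt.
have m0' : (0 < m)%N by rewrite -(ltr0n R).
rewrite ler_distlC; apply/andP; split.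
  rewrite ler_pdivlMr //.
  have cm : (n + N)%:R * `|c n| <= e / 2 * m%:R by near: m; exact: near_le_linear.
  have := iter n (m %/ (n + N))%N (m %% (n + N))%N; rewrite -divn_eq.
  have cE : u n - f n = c n * (n + N)%:R by rewrite /c divfK // gt_eqF // npos.
  rewrite cE -mulr_natl => le.
  have rle : (m %% (n + N))%:R <= (n + N)%:R :> R by rewrite ler_nat ltnW // ltn_mod; lia.
  have mE : m%:R = (m %/ (n + N))%:R * (n + N)%:R + (m %% (n + N))%:R :> R.
    by rewrite -natrM -natrD -divn_eq.
  have rc : (m %% (n + N))%:R * c n <= (n + N)%:R * `|c n|.
    apply: le_trans (ler_wpM2r (normr_ge0 _) rle).
    by rewrite ler_wpM2l // ler_norm.
  have cm2 : (sup S - e / 2) * m%:R <= c n * m%:R by rewrite ler_pM2r // ltW.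
  have : c n * m%:R = (m %/ (n + N))%:R * (c n * (n + N)%:R) + (m %% (n + N))%:R * c n.
    by rewrite {1}mE mulrDr (mulrC _ (c n)) mulrCA.
  lra.
rewrite ler_pdivrMr //.
have cm : c m <= sup S by apply: ub_le_sup; [exists K|exists m].
have : (u m - f m) <= sup S * (m + N)%:R by rewrite -ler_pdivrMr // npos.
have fm : f m <= e / 2 * m%:R by near: m; exact: fo.
have : sup S * N%:R <= e / 2 * m%:R by near: m; exact: near_le_linear.
by rewrite natrD mulrDr; lra.
Unshelve. all: by end_near. Qed.

End Fekete.

(** * Existence of the growth rate *)

Theorem corollary1p3 (R : realType) (G : groupType) (hG : hyperbolic_group R G)
  (H : set G) (hH : is_subgroup H) :
  forall X : set G, finite_generating_set X -> rel_growth_rate_exists R X H.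
Proof.
move=> X fX; have [A [N superM]] := rel_growth_almost_supermult hG fX hH.
have [c expb] := rel_growth_exp H fX.
have b0 n : (0 < (rel_growth X H n)%:R :> R)%R by rewrite ltr0n rel_growth_gt0.
(* Successors make the constants positive, as their logarithms require. *)
have [n|n m|e e0|l lP] := @almost_superadditive_cvg R
    (fun n => ln (rel_growth X H n)%:R) (fun n => ln (A.+1%:R * n.+1%:R))%R
    N (ln c.+1%:R).
- apply/andP; split; first by rewrite ln_ge0 // ler1n rel_growth_gt0.
  rewrite mulr_natr -lnXn ?ltr0n // ler_ln ?posrE ?exprn_gt0 ?ltr0n ?rel_growth_gt0 //.
  rewrite -natrX ler_nat; apply: leq_trans (expb n) _.
  by case: n => // n; rewrite leq_exp2r.
- rewrite /= -!lnM ?posrE ?mulr_gt0 ?ltr0n ?rel_growth_gt0 //.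
  rewrite ler_ln ?posrE ?mulr_gt0 ?ltr0n ?rel_growth_gt0 //.
  rewrite -!natrM ler_nat; apply: leq_trans (superM n m) _.
  by rewrite leq_mul2r leq_mul2r leqnSn !orbT.
- exact: ln_affine_sublinear.
exists (expR l); apply: cvg_trans (continuous_cvg _ (@continuous_expR R l) lP).
apply: near_eq_cvg; near=> n.
rewrite /= /powR gt_eqF //; congr expR; exact: mulrC.
Unshelve. all: by end_near. Qed.
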